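(* Let $\Omega\subset\mathbb{R}^3$ be a bounded (compact) domain with Lipschitz boundary, consisting of a homogeneous isotropic linear elastic material. Then there exists a residual stress field $\sigma$ on $\Omega$, generated by some eigenstrain $\epsilon^*\in C^2(\mathcal{S}^2,\Omega)$, that is not generated by any isotropic eigenstrain, i.e. by any eigenstrain of the form $f\,I$ with $f\in C^2(\Omega)$ a scalar field and $I$ the identity tensor.
   Context: A domain is understood to have nonempty interior. $C^l(\mathcal{S}^m,\Omega)$ denotes the space of rank-$m$ tensor fields on $\Omega$ with continuous $l$-th derivatives ($C^l(\Omega)$ for scalars); strains and eigenstrains are symmetric rank-2 tensor fields. $C$ is the constant positive definite isotropic elasticity tensor of the material, and $[C:A]_{ij}=\sum_{k,l}C_{ijkl}A_{kl}$. The symmetric gradient is $[\nabla_s X]_{ij}=\frac12(\partial_jX_i+\partial_iX_j)$, $[\mathrm{Div}(f)]_j=\sum_i\partial_if_{ij}$, and $n$ is the outward unit normal on $\partial\Omega$. An eigenstrain $\epsilon^*$ generates the residual stress field $\sigma$ if $\sigma=C:(\nabla_sX-\epsilon^* )$, where the displacement field $X$ is the solution (unique up to infinitesimal rigid motions) of the elliptic boundary value problem $\mathrm{Div}(C:\nabla_sX)=\mathrm{Div}(C:\epsilon^* )$ on $\Omega$, $(C:\nabla_sX)\cdot n=(C:\epsilon^* )\cdot n$ on $\partial\Omega$. Equivalently, $\mathrm{Div}(\sigma)=0$ on $\Omega$ and $\sigma\cdot n=0$ on $\partial\Omega$. *)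

(* Defs.v *)
From HB Require Import structures.
From mathcomp Require Import all_boot all_order all_algebra.
From mathcomp Require Import all_classical all_reals all_analysis.

Set Implicit Arguments.
Unset Strict Implicit.
Unset Printing Implicit Defensive.

Import Order.TTheory GRing.Theory Num.Theory.
Import numFieldNormedType.Exports.

Local Open Scope classical_set_scope.
Local Open Scope ring_scope.

(* Points and vectors of R^3 are row vectors; the library's norm on 'rV[R]_3
   is the sup norm, so Euclidean notions go through [dot].  A field on a set A
   is a total function whose values outside A are irrelevant. *)

Section Residual_stress.
Variable R : realType.

Definition vect := 'rV[R]_3.
Definition vector_field := vect -> vect.
Definition tensor_field := vect -> 'M[R]_3.
Definition tensor4 := 'I_3 -> 'I_3 -> 'I_3 -> 'I_3 -> R.

Definition dot (u v : vect) : R := \sum_i u 0 i * v 0 i.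

Definition partial (i : 'I_3) (f : vect -> R) (x : vect) : R :=
  'D_(delta_mx 0 i) f x.

(* For open A this is the usual class C^l(A).  For A compact, the derivatives
   of order at most l exist in the interior and extend continuously to A. *)
Fixpoint class_C (l : nat) (A : set vect) (f : vect -> R) : Prop :=
  match l with
  | 0%N => {within A, continuous f}
  | l'.+1 => {within A, continuous f} /\
      forall i : 'I_3, exists2 g : vect -> R, class_C l' A g &
        forall x, A° x -> is_derive x (delta_mx 0 i) f (g x)
  end.

Definition class_C_vector (l : nat) (A : set vect) (X : vector_field) : Prop :=
  forall i, class_C l A (fun x => X x 0 i).

Definition class_C_tensor (l : nat) (A : set vect) (T : tensor_field) : Prop :=
  forall i j, class_C l A (fun x => T x i j).

Definition symmetric_on (A : set vect) (T : tensor_field) : Prop :=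
  forall x, A x -> (T x)^T = T x.

Definition eigenstrain (Omega : set vect) (eps : tensor_field) : Prop :=
  symmetric_on Omega eps /\ class_C_tensor 2 Omega eps.

Definition isotropic_field (f : vect -> R) : tensor_field := fun x => (f x)%:M.

Definition boundary (A : set vect) : set vect := closure A `\` A°.

(* Near each boundary point, in suitable orthonormal coordinates y, Omega is
   the closed region above the graph of a Lipschitz function of (y_0, y_1). *)
Definition lipschitz_boundary (Omega : set vect) : Prop :=
  forall p, boundary Omega p ->
    exists (Q : 'M[R]_3) (k : R) (gamma : 'rV[R]_2 -> R) (r : R),
      [/\ Q *m Q^T = 1%:M, k.-lipschitz gamma, 0 < r &
        forall x : vect, ball p r x ->
          let y : 'rV[R]_(2 + 1) := (x - p) *m Q in
          Omega x <-> gamma (lsubmx y) <= y 0 ord_max].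

(* n is the outward unit normal at x when the boundary has a tangent plane at x,
   orthogonal to n, with the set on the side opposite to n.  For a set that lies
   above a Lipschitz graph near x, such an n exists iff the graph function is
   differentiable at the corresponding point, and then n is its usual downward
   unit normal.  Since eps is arbitrary, the sup norm may be used for y - x. *)
Definition outward_unit_normal (A : set vect) (x n : vect) : Prop :=
  dot n n = 1 /\
  forall eps : R, 0 < eps -> \forall y \near x,
    (A y -> dot n (y - x) <= eps * `|y - x|) /\
    (~ A y -> - (eps * `|y - x|) <= dot n (y - x)).

Definition ddot (C : tensor4) (A : 'M[R]_3) : 'M[R]_3 :=
  \matrix_(i, j) \sum_k \sum_l C i j k l * A k l.

Definition tensor4_symmetries (C : tensor4) : Prop :=
  forall i j k l,
    [/\ C i j k l = C j i k l, C i j k l = C i j l k & C i j k l = C k l i j].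

Definition tensor4_posdef (C : tensor4) : Prop :=
  forall A : 'M[R]_3, A^T = A -> A != 0 ->
    0 < \sum_i \sum_j A i j * ddot C A i j.

Definition tensor4_isotropic (C : tensor4) : Prop :=
  forall Q : 'M[R]_3, Q *m Q^T = 1%:M -> \det Q = 1 ->
    forall i j k l,
      \sum_p \sum_q \sum_r \sum_s Q i p * Q j q * Q k r * Q l s * C p q r s
        = C i j k l.

Definition isotropic_elasticity_tensor (C : tensor4) : Prop :=
  [/\ tensor4_symmetries C, tensor4_posdef C & tensor4_isotropic C].

Definition symgrad (X : vector_field) : tensor_field := fun x =>
  \matrix_(i, j) (2^-1 * (partial j (fun y => X y 0 i) x +
                          partial i (fun y => X y 0 j) x)).

Definition divergence (T : tensor_field) : vector_field := fun x =>
  \row_j \sum_i partial i (fun y => T y i j) x.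

(* X solves the traction problem with data eps on the compact set Omega.  The
   field E is the symmetric gradient of X, extended continuously from the
   interior to Omega so that it has values on the boundary.  The traction
   condition is imposed wherever the outward unit normal exists. *)
Definition solves_bvp (C : tensor4) (Omega : set vect) (eps : tensor_field)
    (X : vector_field) (E : tensor_field) : Prop :=
  [/\ class_C_vector 2 Omega° X,
      class_C_tensor 0 Omega E,
      (forall x, Omega° x -> E x = symgrad X x),
      (forall x, Omega° x ->
         divergence (fun y => ddot C (symgrad X y)) x =
         divergence (fun y => ddot C (eps y)) x) &
      (forall x n, boundary Omega x -> outward_unit_normal Omega x n ->
         ddot C (E x) *m n^T = ddot C (eps x) *m n^T)].

Definition generates (C : tensor4) (Omega : set vect)
    (eps sigma : tensor_field) : Prop :=
  exists (X : vector_field) (E : tensor_field),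
    solves_bvp C Omega eps X E /\
    forall x, Omega x -> sigma x = ddot C (E x - eps x).

End Residual_stress.

(* Main.v *)
Require Import Defs.
From mathcomp Require Import all_boot all_order all_algebra.
From mathcomp Require Import all_classical all_reals all_analysis.
From mathcomp Require Import ring lra.
Import Order.TTheory GRing.Theory Num.Theory.
Import numFieldNormedType.Exports.
Local Open Scope classical_set_scope.
Local Open Scope ring_scope.

Set Implicit Arguments.
Unset Strict Implicit.
Unset Printing Implicit Defensive.

(** A residual stress supported in a small ball inside the domain needs no
    boundary value problem: if S is symmetric, divergence free and vanishes
    outside such a ball, then the eigenstrain C^-1 : S with zero displacement
    satisfies the equilibrium equation and the traction condition, and generates
    the stress - S.  It remains to choose S so that no isotropic eigenstrain
    generates - S.

    If f I generated - S with displacement X, then on the interior of the domain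
    symgrad X = - C^-1 : S + f I = - S / (2 mu) + h I, where h differs from f by
    a multiple of tr S.  This step uses the Lame form of isotropic tensors,
    C : A = 2 mu A + lam (tr A) I, proved in [lame_law].  The right-hand side then
    satisfies the compatibility equations of Saint-Venant ([saint_venant]), which
    express mixed second derivatives of h by second derivatives of S.

    Take the Airy stress of a potential phi in the plane of the first two axes:
    S_00 = d_1 d_1 phi, S_11 = d_0 d_0 phi, S_01 = - d_0 d_1 phi.  With
    a = - 1 / (2 mu), compatibility gives d_1 (d_0 h) = a d_0 d_1 d_2 d_2 phi and
    d_2 (d_0 h) = - a (d_0 d_1 d_1 d_2 phi + d_0 d_0 d_0 d_2 phi).  Hence the
    mixed derivatives of d_0 h in the directions 1 and 2 can only agree where
    d_0 d_1 d_2 (Laplacian phi) = 0 ([airy_stress_not_conformal]).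

    For the product phi(x) = p(x_0 - c_0) p(x_1 - c_1) p(x_2 - c_2) with
    p(t) = t max(r^2 - t^2, 0)^8, which is C^7 and supported in a ball of the sup
    norm, the value of d_0 d_1 d_2 (Laplacian phi) at c is 3 p'(0)^2 p'''(0),
    which is not zero.

    The solutions X and h are only C^2, so the third derivatives that this
    argument needs must be shown to exist: the second derivatives of X are
    combinations of first derivatives of its strain, and d_0 h has explicit
    first derivatives. *)

(** * Symmetry of mixed directional derivatives *)

(** A directional derivative only sees the function along one line; this moves
    it between functions that agree along their lines, even on different
    spaces. *)
Lemma eq_growth_is_derive (R : numFieldType) (V V' W : normedModType R)
    (f : V -> W) (g : V' -> W) (x v : V) (y w : V') (d : W) :
  (forall h, f (h *: v + x) = g (h *: w + y)) ->
  is_derive x v f d -> is_derive y w g d.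
Proof.
move=> fg [df dE].
have E : (fun h => h^-1 *: ((f \o shift x) (h *: v) - f x)) =
         (fun h => h^-1 *: ((g \o shift y) (h *: w) - g y)).
  apply/funext => h /=; rewrite fg.
  by have := fg 0; rewrite !scale0r !add0r => ->.
by apply: DeriveDef; [move: df; rewrite /derivable E | rewrite -dE /derive E].
Qed.

Lemma is_derive_line (R : numFieldType) (V W : normedModType R)
    (f : V -> W) (x v : V) (t : R) (d : W) :
  is_derive (x + t *: v) v f d -> is_derive t 1 (fun s => f (x + s *: v)) d.
Proof.
apply: eq_growth_is_derive => h.
by rewrite [h%:A]mulr1 scalerDl addrCA.
Qed.

Lemma MVT_line (R : realType) (V : normedModType R) (f df : V -> R) (x v : V)
    (h : R) : 0 <= h ->
  (forall t, 0 <= t <= h -> is_derive (x + t *: v) v f (df (x + t *: v))) ->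
  exists2 c, 0 <= c <= h & f (x + h *: v) - f x = df (x + c *: v) * h.
Proof.
move=> h0 dfE.
have D t : t \in `[0, h]%R ->
    is_derive t 1 (fun s => f (x + s *: v)) (df (x + t *: v)).
  by rewrite in_itv /= => ht; apply/is_derive_line/dfE.
have C : {within `[0, h], continuous (fun s => f (x + s *: v))}.
  by apply: derivable_within_continuous => t /D [].
have D' t : t \in `]0, h[%R ->
    is_derive t 1 (fun s => f (x + s *: v)) (df (x + t *: v)).
  by move=> /subset_itv_oo_cc; exact: D.
have [c ch] := MVT_segment h0 D' C.
by rewrite subr0 scale0r addr0; exists c.
Qed.

(** The second difference of f over a small parallelogram is symmetric in v and w,
    and two applications of the mean value theorem turn it into a value of one
    mixed derivative.  Applied in both orders, this makes the two mixed
    derivatives agree at nearby points. *)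
Lemma double_increment (R : realType) (V : normedModType R)
    (f fv fvw : V -> R) (x v w : V) (h : R) : 0 <= h ->
  (forall s t, 0 <= s <= h -> 0 <= t <= h ->
    is_derive (x + s *: v + t *: w) v f (fv (x + s *: v + t *: w)) /\
    is_derive (x + s *: v + t *: w) w fv (fvw (x + s *: v + t *: w))) ->
  exists st : R * R, [/\ 0 <= st.1 <= h, 0 <= st.2 <= h &
    f (x + h *: v + h *: w) - f (x + h *: v) - f (x + h *: w) + f x =
    fvw (x + st.1 *: v + st.2 *: w) * h * h].
Proof.
move=> h0 H; have hh : 0 <= h <= h by apply/andP; split.
have h00 : 0 <= (0 : R) <= h by rewrite lexx h0.
have [t ht|s hs Es] := @MVT_line _ _ (fun y => f (y + h *: w) - f y)
  (fun y => fv (y + h *: w) - fv y) x v h h0.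
  have [D1 _] := H _ _ ht hh; have [D0 _] := H _ _ ht h00.
  rewrite scale0r addr0 in D0.
  apply: (@is_deriveB _ _ _ (fun y => f (y + h *: w))) => //.
  by apply: eq_growth_is_derive D1 => k; rewrite addrA.
have [t ht|t ht Et] := @MVT_line _ _ fv fvw (x + s *: v) w h h0.
  by have [_] := H _ _ hs ht.
exists (s, t); split => //=; rewrite -Et -Es.
by rewrite opprB addrA [in RHS]addrAC.
Qed.

(** The four derivatives are arbitrary witnesses rather than iterated operators,
    so that the lemma applies to a function, such as the first derivative of a
    C^2 function, whose second derivatives are known from elsewhere. *)
Lemma mixed_derivatives_commute (R : realType) (V : normedModType R) (U : set V)
    (v w : V) (f fv fw fvw fwv : V -> R) :
  open U ->
  (forall x, U x -> is_derive x v f (fv x)) ->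
  (forall x, U x -> is_derive x w f (fw x)) ->
  (forall x, U x -> is_derive x w fv (fvw x)) ->
  (forall x, U x -> is_derive x v fw (fwv x)) ->
  {in U, continuous fvw} -> {in U, continuous fwv} ->
  forall x, U x -> fvw x = fwv x.
Proof.
move=> oU Dv Dw Dvw Dwv cvw cwv x Ux.
apply/eqP; rewrite -subr_eq0 -normr_le0; apply/ler_addgt0Pl => e e0.
rewrite addr0; have e20 : 0 < e / 2 by rewrite divr_gt0.
have /cvgrPdist_lt Cvw : fvw y @[y --> x] --> fvw x by apply: cvw; rewrite inE.
have /cvgrPdist_lt Cwv : fwv y @[y --> x] --> fwv x by apply: cwv; rewrite inE.
have : \forall y \near x, [/\ U y, `|fvw x - fvw y| < e / 2
    & `|fwv x - fwv y| < e / 2].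
  near=> y; split; first by near: y; exact: open_nbhs_nbhs.
  - by near: y; exact: Cvw.
  - by near: y; exact: Cwv.
move=> /nbhs_ballP[d /= d0 Hd].
(* The side h is small enough for the parallelogram at x to stay in the ball of
   radius d; the summand 1 avoids a division by zero when v = w = 0. *)
have N0 : 0 < `|v| + `|w| + 1 by rewrite ltr_wpDl// addr_ge0.
pose h := d / 2 / (`|v| + `|w| + 1).
have h0 : 0 < h by rewrite !divr_gt0.
have inB s t : 0 <= s <= h -> 0 <= t <= h -> ball x d (x + s *: v + t *: w).
  move=> /andP[s0 sh] /andP[t0 th].
  rewrite -ball_normE /ball_ /= -addrA opprD addNKr normrN.
  rewrite (le_lt_trans (ler_normD _ _))// !normrZ !ger0_norm//.
  apply: (@le_lt_trans _ _ (h * (`|v| + `|w| + 1))).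
    rewrite !mulrDr mulr1 -[leLHS]addr0; apply: lerD; last exact: ltW.
    by rewrite lerD// ler_wpM2r.
  by rewrite /h mulfVK ?gt_eqF// ltr_pdivrMr// mulr_natr mulr2n ltrDl.
have [s t hs ht|[s t] /= [hs ht E]] := @double_increment _ _ f fv fvw x v w h (ltW h0).
  by have [Uy _ _] := Hd _ (inB _ _ hs ht); split; [exact: Dv|exact: Dvw].
have [s' t' hs' ht'|[s' t'] /= [hs' ht' E']] :=
    @double_increment _ _ f fw fwv x w v h (ltW h0).
  have := Hd _ (inB _ _ ht' hs'); rewrite addrAC => -[Uy _ _].
  by split; [exact: Dw|exact: Dwv].
have : fvw (x + s *: v + t *: w) = fwv (x + s' *: w + t' *: v).
  apply: (mulIf (lt0r_neq0 h0)); apply: (mulIf (lt0r_neq0 h0)).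
  by rewrite -E -E' (addrAC x); congr (_ + _); exact: addrAC.
move=> EE.
have [_ A _] := Hd _ (inB _ _ hs ht).
have := Hd _ (inB _ _ ht' hs'); rewrite addrAC => -[_ _ B].
rewrite -(subrKA (fvw (x + s *: v + t *: w))) {2}EE.
rewrite (splitr e) (le_trans (ler_normD _ _))// lerD ?ltW//.
by rewrite distrC.
Unshelve. all: by end_near. Qed.

(** * Fields of class C^l *)

Section ClassC.
Variable R : realType.
Implicit Types (l : nat) (i j k : 'I_3) (A B U : set (vect R)).
Implicit Types f g : vect R -> R.

Lemma class_C_continuous l A f : class_C l A f -> {within A, continuous f}.
Proof. by case: l => [|l] // []. Qed.

Lemma class_C_subset l A B f : B `<=` A -> class_C l A f -> class_C l B f.
Proof.
move=> BA; elim: l f => [|l IHl] f /=; first exact: continuous_subspaceW.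
case=> Cf Df; split; first exact: continuous_subspaceW Cf.
move=> i; have [g Cg fg] := Df i; exists g; first exact: IHl.
by move=> x /(interiorS BA); exact: fg.
Qed.

Lemma class_CW l A f : class_C l.+1 A f -> class_C l A f.
Proof.
elim: l f => [|l IHl] f; first by case.
case=> Cf Df; split=> // i; have [g Cg fg] := Df i.
by exists g => //; exact: IHl.
Qed.

Lemma eq_class_C l A f g : (forall x, A x -> f x = g x) ->
  class_C l A f -> class_C l A g.
Proof.
move=> fg Cf; have C0 : {within A, continuous g}.
  have E : {in A, f =1 g} by move=> x; rewrite inE => /fg.
  exact: (subspace_eq_continuous E (class_C_continuous Cf)).
case: l Cf => [|l] // [_ Df]; split=> // i; have [h Ch fh] := Df i.
exists h => // x Ax; apply: near_eq_is_derive (fh x Ax).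
by apply: filterS Ax => y; exact: fg.
Qed.

Lemma class_C_cst l A (a : R) : class_C l A (fun=> a).
Proof.
elim: l a => [|l IHl] a /=; first exact/continuous_subspaceT/cst_continuous.
split; first exact/continuous_subspaceT/cst_continuous.
by move=> i; exists (fun=> 0) => // x _; exact: is_derive_cst.
Qed.

Lemma class_CD l A f g : class_C l A f -> class_C l A g ->
  class_C l A (fun x => f x + g x).
Proof.
elim: l f g => [|l IHl] f g Cf Cg.
  by move=> x; apply: (@continuousD _ _ _ (f : subspace A -> R));
    [exact: Cf|exact: Cg].
split.
  by move=> x; apply: (@continuousD _ _ _ (f : subspace A -> R));
    [exact: Cf.1|exact: Cg.1].
move=> i; have [f' Cf' Df] := Cf.2 i; have [g' Cg' Dg] := Cg.2 i.
exists (fun x => f' x + g' x); first exact: IHl.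
by move=> x Ax; apply: is_deriveD; [exact: Df|exact: Dg].
Qed.

Lemma class_CZ l A (a : R) f : class_C l A f -> class_C l A (fun x => a * f x).
Proof.
elim: l f => [|l IHl] f Cf.
  by move=> x; apply: (@continuousM _ _ (cst a : subspace A -> R));
    [exact: cst_continuous|exact: Cf].
split.
  by move=> x; apply: (@continuousM _ _ (cst a : subspace A -> R));
    [exact: cst_continuous|exact: Cf.1].
move=> i; have [f' Cf' Df] := Cf.2 i; exists (fun x => a * f' x); first exact: IHl.
by move=> x Ax; apply: is_deriveZ; exact: Df.
Qed.

Lemma class_C_mxtrace l A (T : tensor_field R) :
  class_C_tensor l A T -> class_C l A (fun x => \tr (T x)).
Proof.
move=> CT; rewrite /mxtrace; under eq_fun do rewrite !big_ord_recl big_ord0 addr0.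
by apply: class_CD; [exact: CT|apply: class_CD; exact: CT].
Qed.

Lemma class_C_is_derive l U f i x : open U -> class_C l.+1 U f -> U x ->
  is_derive x (delta_mx 0 i) f (partial i f x).
Proof.
move=> oU [_ /(_ i)[g _ fg]] Ux; have := fg x; rewrite (interior_id _).1// => /(_ Ux).
by case=> df _; exact: DeriveDef.
Qed.

Lemma class_C_partial l U f i : open U -> class_C l.+1 U f ->
  class_C l U (partial i f).
Proof.
move=> oU [_ /(_ i)[g Cg fg]]; apply: eq_class_C Cg => x Ux.
by have := fg x; rewrite (interior_id _).1// => /(_ Ux)[].
Qed.

Lemma class_C_intro l U f : open U -> {within U, continuous f} ->
  (forall i, exists2 g, class_C l U g &
     forall x, U x -> is_derive x (delta_mx 0 i) f (g x)) ->
  class_C l.+1 U f.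
Proof.
move=> oU Cf Df; split=> // i; have [g Cg fg] := Df i.
by exists g => // x /interior_subset; exact: fg.
Qed.

Lemma eq_partial U f g i x : open U -> (forall y, U y -> f y = g y) -> U x ->
  partial i f x = partial i g x.
Proof.
move=> oU fg Ux; apply: near_eq_derive.
by apply: filterS (open_nbhs_nbhs (conj oU Ux)) => y; exact: fg.
Qed.

Lemma is_derive_partial f i x d : is_derive x (delta_mx 0 i) f d ->
  partial i f x = d.
Proof. by case. Qed.

Lemma partialD U f g i x : open U -> class_C 1 U f -> class_C 1 U g -> U x ->
  partial i (fun y => f y + g y) x = partial i f x + partial i g x.
Proof.
move=> oU Cf Cg Ux; apply: is_derive_partial; apply: is_deriveD.
  exact: class_C_is_derive Cf Ux.
exact: class_C_is_derive Cg Ux.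
Qed.

Lemma partialZ U f (a : R) i x : open U -> class_C 1 U f -> U x ->
  partial i (fun y => a * f y) x = a * partial i f x.
Proof.
move=> oU Cf Ux; apply: is_derive_partial; apply: is_deriveZ.
exact: class_C_is_derive Cf Ux.
Qed.

Lemma partial2D U f g i j x : open U -> class_C 2 U f -> class_C 2 U g -> U x ->
  partial i (partial j (fun y => f y + g y)) x =
  partial i (partial j f) x + partial i (partial j g) x.
Proof.
move=> oU Cf Cg Ux.
have E y : U y -> partial j (fun y => f y + g y) y = partial j f y + partial j g y.
  by apply: partialD => //; exact: class_CW.
by rewrite (eq_partial i oU E Ux); apply: (partialD i oU) => //;
  exact: class_C_partial.
Qed.

Lemma partialC U f i j x : open U -> class_C 2 U f -> U x ->
  partial i (partial j f) x = partial j (partial i f) x.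
Proof.
move=> oU Cf Ux; have Cp k := class_C_partial k oU Cf.
have Cpp k k' : {in U, continuous (partial k (partial k' f))}.
  rewrite -continuous_open_subspace//.
  exact: class_C_continuous (class_C_partial k oU (Cp k')).
apply: (@mixed_derivatives_commute R _ U (delta_mx 0 j) (delta_mx 0 i)
  f (partial j f) (partial i f)) => //.
- by move=> y Uy; exact: class_C_is_derive Cf Uy.
- by move=> y Uy; exact: class_C_is_derive Cf Uy.
- by move=> y Uy; exact: class_C_is_derive (Cp j) Uy.
- by move=> y Uy; exact: class_C_is_derive (Cp i) Uy.
Qed.

End ClassC.

(** * A compactly supported function of one variable *)

Section Bump.
Variable R : realType.
Implicit Types (r t u : R) (m n : nat).

Definition pos_part u : R := Num.max u 0.

Lemma pos_part_continuous : continuous pos_part.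
Proof.
by move=> u; apply: continuous_max; [exact: cvg_id|exact: cst_continuous].
Qed.

Lemma is_derive_exprn n u :
  is_derive u 1 (fun s : R => s ^+ n) (n%:R * u ^+ n.-1).
Proof.
apply: DeriveDef; first exact: exprn_derivable.
by rewrite exp_derive [_%:A]mulr1.
Qed.

(** Powers of exponent at least 2 smooth out the corner of the positive part: at 0
    the difference quotient is itself a positive power of the positive part. *)
Lemma is_derive_pos_partX n u :
  is_derive u 1 (fun s => pos_part s ^+ n.+2) (n.+2%:R * pos_part u ^+ n.+1).
Proof.
have [u0|u0|->] := ltgtP u 0.
- have -> : pos_part u = 0 by rewrite /pos_part max_r// ltW.
  rewrite exprS mul0r mulr0.
  apply: near_eq_is_derive (is_derive_cst (0 : R) u 1).
  near=> s; rewrite /pos_part max_r ?exprS ?mul0r//.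
  by apply: ltW; near: s; exact: lt_nbhsl.
- have -> : pos_part u = u by rewrite /pos_part max_l// ltW.
  apply: near_eq_is_derive (is_derive_exprn n.+2 u); near=> s; rewrite /pos_part max_l//.
  by apply: ltW; near: s; exact: lt_nbhsr.
have P0 : pos_part 0 = 0 by rewrite /pos_part max_r.
rewrite P0 exprS mul0r mulr0.
have H : (fun h => h^-1 *: (((fun s => pos_part s ^+ n.+2) \o shift 0) h%:A
    - pos_part 0 ^+ n.+2)) @ 0^' --> (0 : R).
  have C : pos_part x ^+ n.+1 @[x --> 0^'] --> pos_part 0 ^+ n.+1.
    apply: cvg_within_filter.
    apply: (@continuous_comp _ _ _ pos_part (fun s => s ^+ n.+1)).
      exact: pos_part_continuous.
    exact: exprn_continuous.
  rewrite P0 exprS mul0r in C.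
  apply: cvg_trans C; apply: near_eq_cvg; near=> h.
  have h0 : h != 0 by near: h; apply: withinT.
  rewrite /= [h%:A]mulr1 addr0 P0 (exprS 0 n.+1) mul0r subr0 /pos_part.
  have [h1|h1|h1] := ltgtP h 0.
  - by rewrite !exprS !mul0r scaler0.
  - by rewrite [in RHS]exprS [RHS]mulKf.
  - by rewrite h1 eqxx in h0.
by apply: DeriveDef; [apply/cvg_ex; exists 0|exact: cvg_lim].
Unshelve. all: by end_near. Qed.

Definition bump_factor r t : R := pos_part (r ^+ 2 - t ^+ 2).

Lemma bump_factor_continuous r : continuous (bump_factor r).
Proof.
move=> t; apply: (@continuous_comp _ _ _ (fun s : R => r ^+ 2 - s ^+ 2) pos_part).
  apply: continuousB; first exact: cst_continuous.
  exact: exprn_continuous.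
exact: pos_part_continuous.
Qed.

(** Writing w for the positive part of r^2 - t^2, the derivative of q w^k is
    (q' (r^2 - t^2) - 2 k t q) w^(k-1).  Starting from t w^8, the n-th derivative
    is therefore [bump_poly r n] times w^(8-n). *)
Fixpoint bump_poly r n : {poly R} :=
  if n is m.+1 then
    (bump_poly r m)^`() * ((r ^+ 2)%:P - 'X^2)
    - ((8 - m).*2%:R)%:P * 'X * bump_poly r m
  else 'X.

Definition bump_deriv r n t : R := (bump_poly r n).[t] * bump_factor r t ^+ (8 - n).

Lemma is_derive_bump_deriv r n t : (n < 7)%N ->
  is_derive t 1 (bump_deriv r n) (bump_deriv r n.+1 t).
Proof.
move=> n7; rewrite /bump_deriv /=.
have [m -> ->] : exists2 m, (8 - n = m.+2)%N & (8 - n.+1 = m.+1)%N.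
  have n6 : (n <= 6)%N by [].
  by exists (6 - n)%N; rewrite ?subSS -!subSn// leqW.
have D1 := is_derive_poly (bump_poly r n) t.
have D2 : is_derive t 1 (fun s : R => r ^+ 2 - s ^+ 2) (- (2%:R * t)).
  have := is_deriveB (is_derive_cst (r ^+ 2) t 1) (is_derive_exprn 2 t).
  by rewrite sub0r expr1.
have D3 := @is_derive1_comp _ (fun u => pos_part u ^+ m.+2) _ t _ _
  (is_derive_pos_partX m (r ^+ 2 - t ^+ 2)) D2.
apply: is_derive_eq (is_deriveM D1 D3) _.
rewrite !hornerE /= -/(bump_factor r t).
have -> : bump_factor r t ^+ m.+2 =
    (r ^+ 2 - t ^+ 2) * bump_factor r t ^+ m.+1.
  rewrite [in LHS]exprS /bump_factor /pos_part.
  by case: ltgtP => [_|_|->] //; rewrite !exprS !mul0r ?mulr0.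
rewrite /GRing.scale /= -mul2n natrM.
by ring.
Qed.

Lemma bump_deriv_continuous r n : continuous (bump_deriv r n).
Proof.
move=> t; apply: (@continuousM _ _ (horner (bump_poly r n))).
  exact: continuous_horner.
apply: (@continuous_comp _ _ _ (bump_factor r) (fun s => s ^+ (8 - n))).
  exact: bump_factor_continuous.
exact: exprn_continuous.
Qed.

Lemma bump_deriv_outside r n t : 0 <= r -> (n < 8)%N -> r <= `|t| -> bump_deriv r n t = 0.
Proof.
move=> r0 n8 rt; rewrite /bump_deriv /bump_factor /pos_part max_r.
  by rewrite expr0n subn_eq0 leqNgt n8 mulr0.
by rewrite subr_le0 -(real_normK (num_real t)) lerXn2r// nnegrE.
Qed.

(** The factor t of t (r^2 - t^2)^8 makes its odd derivatives survive at 0; the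
    first and third are those that occur in the obstruction below. *)
Lemma bump_deriv_at0 r : 0 < r -> bump_deriv r 1 0 ^+ 2 * bump_deriv r 3 0 != 0.
Proof.
move=> r0.
have -> : bump_deriv r 1 0 = r ^+ 16.
  rewrite /bump_deriv /bump_factor /pos_part max_l expr0n ?subr0 ?sqr_ge0//=.
  rewrite !poly.derivE !hornerE /= -?[(8 - 0).*2]/16%N -?[(8 - 1).*2]/14%N; ring.
have -> : bump_deriv r 3 0 = - (48%:R * r ^+ 14).
  rewrite /bump_deriv /bump_factor /pos_part max_l expr0n ?subr0 ?sqr_ge0//=.
  rewrite !poly.derivE !hornerE /= -?[(8 - 0).*2]/16%N -?[(8 - 1).*2]/14%N; ring.
have rn k : r ^+ k != 0 by rewrite expf_neq0// gt_eqF.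
apply: mulf_neq0; first by rewrite expf_neq0.
by rewrite oppr_eq0 mulf_neq0 ?pnatr_eq0.
Qed.

End Bump.

(** * Derivatives of the Airy potential *)

Section BumpProduct.
Variables (R : realType) (r : R) (c : vect R).
Implicit Types (s : seq nat) (x : vect R).

(** The list s is a multi-index: the potential is the product of three copies of
    t (r^2 - t^2)^8, cut off at r, in the coordinates of x - c, and
    [potential_deriv s] is its partial derivative of order s.  Differentiation in
    the direction i then acts on s as [incr_nth]. *)
Definition potential_deriv s x : R :=
  \prod_(i < 3) bump_deriv r (nth 0%N s i) (x 0 i - c 0 i).

Lemma is_derive_potential_deriv s (i : 'I_3) x : (nth 0%N s i < 7)%N ->
  is_derive x (delta_mx 0 i) (potential_deriv s) (potential_deriv (incr_nth s i) x).
Proof.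
move=> si7.
pose K := \prod_(j < 3 | j != i) bump_deriv r (nth 0%N s j) (x 0 j - c 0 j).
have D : is_derive (x 0 i - c 0 i) 1 (fun t => K * bump_deriv r (nth 0%N s i) t)
    (potential_deriv (incr_nth s i) x).
  have -> : potential_deriv (incr_nth s i) x =
      K * bump_deriv r (nth 0%N s i).+1 (x 0 i - c 0 i).
    rewrite /potential_deriv (bigD1 i)//= mulrC nth_incr_nth eqxx.
    congr (_ * _); apply: eq_bigr => j ji.
    by rewrite nth_incr_nth (negbTE (_ : i != j :> nat))// eq_sym.
  by apply: is_deriveZ; exact: is_derive_bump_deriv.
apply: eq_growth_is_derive D => h; rewrite /potential_deriv (bigD1 i)//= [RHS]mulrC.
congr (_ * _); last by rewrite !mxE !eqxx /= mulr1 [h%:A]mulr1 addrA.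
apply: eq_bigr => j ji.
by rewrite !mxE (negbTE ji) mulr0 add0r.
Qed.

Lemma potential_deriv_continuous s : continuous (potential_deriv s).
Proof.
pose f (i : 'I_3) (x : vect R) := bump_deriv r (nth 0%N s i) (x 0 i - c 0 i).
have C i : continuous (f i).
  move=> x; apply: (@continuous_comp _ _ _ (fun x : vect R => x 0 i - c 0 i)).
    by apply: continuousB; [exact: coord_continuous|exact: cst_continuous].
  exact: bump_deriv_continuous.
have -> : potential_deriv s = fun x => f 0 x * (f 1 x * f 2%:R x).
  apply/funext => x; rewrite /potential_deriv !big_ord_recl big_ord0 mulr1.
  by congr (f _ x * (f _ x * f _ x)); apply: val_inj.
move=> x; apply: (@continuousM _ _ (f 0) (fun x => f 1 x * f 2%:R x)).
  exact: C.
by apply: (@continuousM _ _ (f 1) (f 2%:R)); exact: C.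
Qed.

Lemma class_C_potential_deriv l s (A : set (vect R)) :
  (forall i : 'I_3, nth 0%N s i + l <= 7)%N -> class_C l A (potential_deriv s).
Proof.
elim: l s => [|l IHl] s sl /=.
  exact/continuous_subspaceT/potential_deriv_continuous.
split; first exact/continuous_subspaceT/potential_deriv_continuous.
move=> i; exists (potential_deriv (incr_nth s i)).
  apply: IHl => j; rewrite nth_incr_nth; apply: leq_trans (sl j).
  by rewrite addnS -addSn leq_add2r; case: (_ == _); rewrite ?leqnn ?leqW.
move=> x _; apply: is_derive_potential_deriv.
by apply: leq_trans (sl i); rewrite addnS ltnS leq_addr.
Qed.

Lemma partial_potential_deriv s (i : 'I_3) x : (nth 0%N s i < 7)%N ->
  partial i (potential_deriv s) x = potential_deriv (incr_nth s i) x.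
Proof. by move=> s7; apply: is_derive_partial; exact: is_derive_potential_deriv. Qed.

Lemma potential_deriv_outside s x : 0 < r -> (forall i : 'I_3, nth 0%N s i < 8)%N ->
  ~ ball c r x -> potential_deriv s x = 0.
Proof.
move=> r0 s8 xB.
have [i ri] : exists i : 'I_3, r <= `|x 0 i - c 0 i|.
  apply: contrapT => H; apply: xB; split=> // a i; rewrite (ord1 a).
  rewrite -ball_normE /ball_ /= distrC ltNge; apply/negP => h.
  by apply: H; exists i.
by rewrite /potential_deriv (bigD1 i)//= bump_deriv_outside ?mul0r// ltW.
Qed.

End BumpProduct.

(** * Isotropic elasticity tensors *)

Lemma ord3_cases (P : 'I_3 -> Prop) : P 0 -> P 1 -> P 2 -> forall i, P i.
Proof.
move=> P0 P1 P2; case; case=> [|[|[|//]]] lti.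
- by rewrite (_ : Ordinal lti = 0)//; apply: val_inj.
- by rewrite (_ : Ordinal lti = 1)//; apply: val_inj.
- by rewrite (_ : Ordinal lti = 2)//; apply: val_inj.
Qed.

Lemma det_mx3 (R : comNzRingType) (A : 'M[R]_3) :
  \det A = A 0 0 * (A 1 1 * A 2 2 - A 1 2 * A 2 1)
          - A 0 1 * (A 1 0 * A 2 2 - A 1 2 * A 2 0)
          + A 0 2 * (A 1 0 * A 2 1 - A 1 1 * A 2 0).
Proof.
(* Reading entries through natural numbers lets the iterated lifts of the
   expansion reduce by computation. *)
pose f (m n : nat) := A (inord m) (inord n).
have E i j : A i j = f i j by rewrite /f !inord_val.
rewrite (expand_det_row _ ord0) !big_ord_recl big_ord0 /cofactor.
rewrite !(expand_det_row _ ord0) !big_ord_recl !big_ord0 /cofactor.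
by rewrite !det_mx11 !mxE !E /= /bump /=; ring.
Qed.

Section Elasticity.
Variables (R : realType) (C : tensor4 R).
Hypothesis C_elastic : isotropic_elasticity_tensor C.
Implicit Types (i j k l : 'I_3) (A : 'M[R]_3).

(** For a rotation that permutes the axes up to sign, the fourfold sum in the
    invariance condition has a single nonzero term. *)
Lemma isotropic_signed_perm (p : 'I_3 -> 'I_3) (e : 'I_3 -> R) :
  let Q : 'M[R]_3 := \matrix_(i, j) (e i * (j == p i)%:R) in
  Q *m Q^T = 1%:M -> \det Q = 1 ->
  forall i j k l,
    C i j k l = e i * e j * e k * e l * C (p i) (p j) (p k) (p l).
Proof.
move=> Q QQ dQ i j k l; have [_ _ iso] := C_elastic.
rewrite -[LHS](iso Q QQ dQ) (bigD1 (p i))//= [X in _ + X]big1 ?addr0; last first.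
  move=> a /negbTE ai; apply: big1 => b _; apply: big1 => d _; apply: big1 => f _.
  by rewrite mxE ai mulr0 !mul0r.
rewrite (bigD1 (p j))//= [X in _ + X]big1 ?addr0; last first.
  move=> b /negbTE bj; apply: big1 => d _; apply: big1 => f _.
  by rewrite [Q j b]mxE bj !mulr0 !mul0r.
rewrite (bigD1 (p k))//= [X in _ + X]big1 ?addr0; last first.
  move=> d /negbTE dk; apply: big1 => f _.
  by rewrite [Q k d]mxE dk !mulr0 !mul0r.
rewrite (bigD1 (p l))//= [X in _ + X]big1 ?addr0; last first.
  by move=> f /negbTE fl; rewrite [Q l f]mxE fl !mulr0 !mul0r.
by rewrite !mxE !eqxx /= !mulr1.
Qed.

(** The half turn about axis m changes the sign of the component. *)
Lemma isotropic_odd (m : 'I_3) i j k l :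
  odd ((i == m) + (j == m) + (k == m) + (l == m)) -> C i j k l = 0.
Proof.
pose e (i : 'I_3) : R := (-1) ^+ (i != m).
have ee a : e a * e a = 1 by rewrite /e -expr2 sqrr_sign.
have QE : \matrix_(i, j) (e i * (j == i)%:R) = diag_mx (\row_i e i) :> 'M[R]_3.
  by apply/matrixP => a b; rewrite !mxE eq_sym mulr_natr.
have := @isotropic_signed_perm id e; rewrite /= QE => H.
move=> codd; have /H /(_ _ i j k l) E :
    diag_mx (\row_i e i) *m (diag_mx (\row_i e i))^T = 1%:M.
  rewrite tr_diag_mx mulmx_diag; apply/matrixP => a b; rewrite !mxE ee.
  by [].
have {}E : C i j k l = - C i j k l.
  rewrite {1}E.
    rewrite -[RHS]mulN1r; congr (_ * _); rewrite /e -!exprD.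
    move: codd; case: (i == m); case: (j == m); case: (k == m); case: (l == m) => //= _; ring.
  rewrite det_diag !big_ord_recl big_ord0 !mxE /e.
  by elim/ord3_cases : m {H E codd ee QE e} => /=; ring.
lra.
Qed.

(** Addition in 'I_3 is modulo 3, so the shift by t is a rotation about the
    diagonal (1, 1, 1). *)
Lemma isotropic_shift t i j k l :
  C (i + t) (j + t) (k + t) (l + t) = C i j k l.
Proof.
have S i' j' k' l' : C i' j' k' l' = C (i' + 1) (j' + 1) (k' + 1) (l' + 1).
  rewrite (@isotropic_signed_perm (+%R^~ 1) (fun=> 1)) ?mul1r//.
    apply/matrixP; elim/ord3_cases; elim/ord3_cases;
      rewrite !mxE !big_ord_recl big_ord0 !mxE /=; ring.
  by rewrite det_mx3 !mxE /=; ring.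
elim/ord3_cases: t; first by rewrite !addr0.
  by rewrite -S.
by rewrite (_ : 2 = 1 + 1)// !addrA -!S.
Qed.

Lemma tensor4_sym : [/\ forall i j k l, C i j k l = C j i k l,
  forall i j k l, C i j k l = C i j l k & forall i j k l, C i j k l = C k l i j].
Proof. by have [sym _ _] := C_elastic; split=> i j k l; have [] := sym i j k l. Qed.

Lemma isotropic_iijj i j : i != j -> C i i j j = C 0 0 1 1.
Proof.
have [_ _ S] := tensor4_sym.
have L t : C t t (t + 1) (t + 1) = C 0 0 1 1.
  by rewrite -[RHS](isotropic_shift t) !add0r (addrC 1).
move: (L 0) (L 1) (L 2).
rewrite add0r (_ : 1 + 1 = 2)// (_ : 2 + 1 = 0); last exact: val_inj.
move=> L0 L1 L2.
elim/ord3_cases: i; elim/ord3_cases: j => // _.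
all: by rewrite ?L1 ?L2 // [LHS]S ?L1 ?L2.
Qed.

Lemma isotropic_ijij i j : i != j -> C i j i j = C 0 1 0 1.
Proof.
have [S1 S2 _] := tensor4_sym.
have L t : C t (t + 1) t (t + 1) = C 0 1 0 1.
  by rewrite -[RHS](isotropic_shift t) !add0r (addrC 1).
move: (L 0) (L 1) (L 2).
rewrite add0r (_ : 1 + 1 = 2)// (_ : 2 + 1 = 0); last exact: val_inj.
move=> L0 L1 L2.
elim/ord3_cases: i; elim/ord3_cases: j => // _.
all: by rewrite ?L1 ?L2 // [LHS]S1 [LHS]S2 ?L1 ?L2.
Qed.

(** Rotations that permute the axes leave three constants; the relation between
    them comes from a rotation by an angle that is not a multiple of a right
    angle.  The one with cosine 3/5 and sine 4/5 has rational entries. *)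
Lemma isotropic_iiii i : C i i i i = C 0 0 1 1 + 2 * C 0 1 0 1.
Proof.
have [S1 S2 _] := tensor4_sym.
have -> : C i i i i = C 0 0 0 0 by rewrite -[RHS](isotropic_shift i) !add0r.
pose Q : 'M[R]_3 := \matrix_(i, j) nth 0 (nth [::]
  [:: [:: 3 / 5; 4 / 5; 0]; [:: - (4 / 5); 3 / 5; 0]; [:: 0; 0; 1]] i) j.
have QQ : Q *m Q^T = 1%:M.
  apply/matrixP; elim/ord3_cases; elim/ord3_cases;
    rewrite !mxE !big_ord_recl big_ord0 !mxE /=; lra.
have dQ : \det Q = 1 by rewrite det_mx3 !mxE /=; lra.
have [_ _ iso] := C_elastic; have := iso Q QQ dQ 0 0 0 0.
have K (F : 'I_3 -> R) : \sum_s Q 0 s * F s = 3 / 5 * F 0 + 4 / 5 * F 1.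
  rewrite !big_ord_recl big_ord0 !mxE /= mul0r !addr0.
  by congr (_ * F _ + _ * F _); apply: val_inj.
have -> : \sum_p \sum_q \sum_r \sum_s Q 0 p * Q 0 q * Q 0 r * Q 0 s * C p q r s
  = \sum_p Q 0 p * \sum_q Q 0 q * \sum_r Q 0 r * \sum_s Q 0 s * C p q r s.
  apply: eq_bigr => p _; rewrite mulr_sumr; apply: eq_bigr => q _.
  rewrite !mulrA mulr_sumr; apply: eq_bigr => r _.
  by rewrite mulrA mulr_sumr; apply: eq_bigr => s _; rewrite !mulrA.
(* Of the sixteen remaining components, the eight with an odd number of indices
   0 vanish. *)
have Z (j k l m : 'I_3) := @isotropic_odd 0 j k l m.
rewrite !K (Z 0 0 0 1)// (Z 0 0 1 0)// (Z 0 1 0 0)// (Z 1 0 0 0)//.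
rewrite (Z 1 1 1 0)// (Z 1 1 0 1)// (Z 1 0 1 1)// (Z 0 1 1 1)//.
rewrite [C 1 1 0 0]isotropic_iijj// [C 1 0 0 1]S1 [C 0 1 1 0]S2.
rewrite [C 1 0 1 0]S1 [C 0 1 1 0]S2.
have -> : C 1 1 1 1 = C 0 0 0 0 by rewrite -[RHS](isotropic_shift 1) !add0r.
by lra.
Qed.

(** Unless the four indices fall into two pairs of equal ones, some index occurs
    an odd number of times, so that [isotropic_odd] applies. *)
Lemma isotropic_components i j k l :
  C i j k l = C 0 0 1 1 * ((i == j) && (k == l))%:R
    + C 0 1 0 1 * (((i == k) && (j == l))%:R + ((i == l) && (j == k))%:R).
Proof.
have [S1 S2 _] := tensor4_sym.
have Z m : odd ((i == m) + (j == m) + (k == m) + (l == m)) -> C i j k l = 0.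
  exact: isotropic_odd.
have [ij|ij] := eqVneq i j; [subst j|]; have [kl|kl] := eqVneq k l; [subst l| | subst l|].
- have [ik|ik] := eqVneq i k; first by subst k; rewrite isotropic_iiii ?eqxx /=; ring.
  by rewrite isotropic_iijj// ?eqxx ?(negbTE ik) /=; ring.
- rewrite (Z k); last by rewrite eqxx (eq_sym l) (negbTE kl); case: (i == k).
  by have [->|ik] := eqVneq i k; rewrite /= ?(negbTE kl) ?andbF /=; ring.
- rewrite (Z i); last by rewrite eqxx (eq_sym j) (negbTE ij); case: (k == i).
  have [ik|ik] := eqVneq i k; last by rewrite /=; ring.
  by rewrite -ik (eq_sym j) (negbTE ij) /=; ring.
have [ik|ik] := eqVneq i k.
  subst k; have [jl|jl] := eqVneq j l.
    by subst l; rewrite isotropic_ijij// ?eqxx ?(negbTE ij) /=; ring.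
  rewrite (Z j); last by rewrite eqxx (negbTE ij) (eq_sym l) (negbTE jl).
  by rewrite (negbTE kl) /=; ring.
have [il|il] := eqVneq i l.
  subst l; have [jk|jk] := eqVneq j k.
    by subst k; rewrite S2 isotropic_ijij// ?eqxx ?(negbTE ij) ?(negbTE ik) /=; ring.
  rewrite (Z j); last by rewrite eqxx (negbTE ij) (eq_sym k) (negbTE jk).
  by rewrite /=; ring.
rewrite (Z i) /=; first by ring.
by rewrite eqxx (eq_sym j) (negbTE ij) (eq_sym k) (negbTE ik) (eq_sym l) (negbTE il).
Qed.

(** The two inequalities are positive definiteness at the shear with entries 01 and
    10 equal to 1, and at the identity. *)
Lemma lame_law : exists lam mu : R, [/\ 0 < mu, 0 < 2 * mu + 3 * lam &
  forall A, A^T = A -> ddot C A = (2 * mu) *: A + (lam * \tr A)%:M].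
Proof.
pose lam := C 0 0 1 1; pose mu := C 0 1 0 1.
have CE A : A^T = A -> ddot C A = (2 * mu) *: A + (lam * \tr A)%:M.
  move=> AT; apply/matrixP => i j; rewrite !mxE.
  have E k l : C i j k l * A k l = (k == l)%:R * (lam * (i == j)%:R * A k l)
      + ((k == i)%:R * ((l == j)%:R * (mu * A k l))
      + (k == j)%:R * ((l == i)%:R * (mu * A k l))).
    rewrite isotropic_components -/lam -/mu -!mulnb !natrM.
    rewrite (eq_sym i k) (eq_sym j l) (eq_sym i l) (eq_sym j k); ring.
  have pick (F : 'I_3 -> R) k : \sum_l (l == k)%:R * F l = F k.
    rewrite (bigD1 k)//= eqxx mul1r big1 ?addr0// => l /negbTE ->.
    by rewrite mul0r.
  have pick' (F : 'I_3 -> R) k : \sum_l (k == l)%:R * F l = F k.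
    by under eq_bigr do rewrite eq_sym; exact: pick.
  under eq_bigr do under eq_bigr do rewrite E.
  under eq_bigr do rewrite !big_split /= -!mulr_sumr pick' !pick.
  rewrite !big_split /= !pick -mulr_sumr -/(\tr A).
  have -> : A j i = A i j by rewrite -[in RHS]AT mxE.
  by rewrite -mulr_natr; ring.
exists lam, mu; have [_ pos _] := C_elastic; split=> //.
- pose A : 'M[R]_3 := delta_mx 0 1 + delta_mx 1 0.
  have AT : A^T = A by rewrite /A linearD /= !trmx_delta addrC.
  have A0 : A != 0.
    by apply/eqP => /matrixP/(_ 0 1); rewrite !mxE /= => /eqP; rewrite addr0 oner_eq0.
  have := pos A AT A0; rewrite CE//.
  rewrite !big_ord_recl !big_ord0 /mxtrace !big_ord_recl !big_ord0 !mxE /=; lra.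
- have := pos 1%:M (trmx1 _ _) (oner_neq0 _); rewrite CE ?trmx1//.
  rewrite !big_ord_recl !big_ord0 /mxtrace !big_ord_recl !big_ord0 !mxE /=; lra.
Qed.

End Elasticity.

(** The inverse of A |-> 2 mu A + lam (tr A) I on symmetric matrices. *)
Definition compliance (R : realType) (lam mu : R) (A : 'M[R]_3) : 'M[R]_3 :=
  (2 * mu)^-1 *: A + (- (lam / (2 * mu * (2 * mu + 3 * lam))) * \tr A)%:M.

Section Compliance.
Variables (R : realType) (C : tensor4 R) (lam mu : R).
Hypotheses (mu0 : 0 < mu) (k0 : 0 < 2 * mu + 3 * lam).
Hypothesis CE : forall A, A^T = A -> ddot C A = (2 * mu) *: A + (lam * \tr A)%:M.

Lemma mxtrace_addM (a b : R) (A : 'M[R]_3) :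
  \tr (a *: A + b%:M) = a * \tr A + 3 * b.
Proof. by rewrite mxtraceD mxtraceZ mxtrace_scalar mulr_natl. Qed.

Lemma compliance_sym A : A^T = A -> (compliance lam mu A)^T = compliance lam mu A.
Proof. by move=> AT; rewrite linearD linearZ /= tr_scalar_mx AT. Qed.

Lemma ddot_compliance A : A^T = A -> ddot C (compliance lam mu A) = A.
Proof.
move=> AT; rewrite CE; last exact: compliance_sym.
rewrite mxtrace_addM; apply/matrixP => i j; rewrite !mxE.
move: (\tr A) (A i j) => t u.
have [m0 n0] : mu != 0 /\ 2 * mu + 3 * lam != 0 by rewrite !gt_eqF.
by case: (i == j); rewrite ?mulr1n ?mulr0n; field; rewrite ?m0 ?n0.
Qed.

Lemma compliance_ddot A : A^T = A -> compliance lam mu (ddot C A) = A.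
Proof.
move=> AT; rewrite CE// /compliance mxtrace_addM; apply/matrixP => i j; rewrite !mxE.
move: (\tr A) (A i j) => t u.
have [m0 n0] : mu != 0 /\ 2 * mu + 3 * lam != 0 by rewrite !gt_eqF.
by case: (i == j); rewrite ?mulr1n ?mulr0n; field; rewrite ?m0 ?n0.
Qed.

End Compliance.

Lemma class_C_compliance (R : realType) (lam mu : R) l (A : set (vect R))
    (T : tensor_field R) :
  class_C_tensor l A T -> class_C_tensor l A (fun x => compliance lam mu (T x)).
Proof.
move=> CT i j; pose b := (- (lam / (2 * mu * (2 * mu + 3 * lam)))) *+ (i == j).
apply: (@eq_class_C _ _ _ (fun x => (2 * mu)^-1 * T x i j + b * \tr (T x))).
  by move=> x _; rewrite !mxE -mulrnAl.
by apply: class_CD; apply: class_CZ; [exact: CT|exact: class_C_mxtrace].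
Qed.

(** * The compatibility equations of Saint-Venant *)

Section Compatibility.
Variable R : realType.
Implicit Types (U : set (vect R)) (i j k l : 'I_3) (f g : vect R -> R).

Lemma partial_symgrad U (X : vector_field R) i j k x : open U ->
  class_C_vector 2 U X -> U x ->
  partial i (fun y => symgrad X y j k) x =
    2^-1 * (partial i (partial k (fun y => X y 0 j)) x
            + partial i (partial j (fun y => X y 0 k)) x).
Proof.
move=> oU CX Ux; have Cp a b := class_C_partial b oU (CX a).
have E y : U y -> symgrad X y j k = 2^-1 *
    (partial k (fun y => X y 0 j) y + partial j (fun y => X y 0 k) y).
  by rewrite mxE.
rewrite (eq_partial i oU E Ux) (partialZ _ _ oU _ Ux); last exact: class_CD.
by rewrite (partialD _ oU _ _ Ux).
Qed.

(** Up to a factor, the Christoffel symbols of the first kind of the metric e: as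
    for a flat metric, they recover the second derivatives of the displacement. *)
Definition christoffel (e : tensor_field R) i j k x : R :=
  partial i (fun y => e y j k) x + partial j (fun y => e y i k) x
  + -1 * partial k (fun y => e y i j) x.

Lemma class_C_christoffel U (m : nat) (e : tensor_field R) i j k : open U ->
  class_C_tensor m.+1 U e -> class_C m U (christoffel e i j k).
Proof.
move=> oU Ce; have P a b c : class_C m U (partial a (fun y => e y b c)).
  exact: class_C_partial.
by apply: class_CD; [exact: class_CD|exact: class_CZ].
Qed.

Lemma partial2_displacement U (X : vector_field R) i j k x : open U ->
  class_C_vector 2 U X -> U x ->
  partial i (partial j (fun y => X y 0 k)) x = christoffel (symgrad X) i j k x.
Proof.
move=> oU CX Ux; rewrite /christoffel !(partial_symgrad _ _ _ oU CX Ux).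
rewrite (partialC j i oU (CX k) Ux) (partialC k j oU (CX i) Ux).
rewrite (partialC k i oU (CX j) Ux).
move: (partial i (partial j _) x) (partial i (partial k _) x) => a b.
by move: (partial j (partial k _) x) => c; lra.
Qed.

(** A C^2 displacement with C^2 strain is in fact C^3, because its second
    derivatives are the combinations [christoffel] of first derivatives of the
    strain.  The equations express the symmetry in l and i of the third
    derivatives d_l d_i d_j X_k. *)
Lemma saint_venant U (X : vector_field R) i j k l x : open U ->
  class_C_vector 2 U X -> class_C_tensor 2 U (symgrad X) -> U x ->
  let dd a b c d := partial a (partial b (fun y => symgrad X y c d)) x in
  dd l j i k - dd l k i j = dd i j l k - dd i k l j.
Proof.
move=> oU CX Ce Ux dd.
have C2 : class_C 2 U (partial j (fun y => X y 0 k)).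
  apply: class_C_intro => // [|a].
    exact: class_C_continuous (class_C_partial j oU (CX k)).
  exists (christoffel (symgrad X) a j k); first exact: class_C_christoffel.
  move=> y Uy; rewrite -(partial2_displacement a j k oU CX Uy).
  exact: class_C_is_derive (class_C_partial j oU (CX k)) Uy.
have P a b c : class_C 1 U (partial a (fun y => symgrad X y b c)).
  exact: class_C_partial.
have E a b : partial a (partial b (partial j (fun y => X y 0 k))) x =
    dd a b j k + dd a j b k - dd a k b j.
  have H y : U y -> partial b (partial j (fun y => X y 0 k)) y =
      christoffel (symgrad X) b j k y.
    exact: partial2_displacement.
  rewrite (eq_partial a oU H Ux).
  rewrite (partialD _ oU (class_CD (P b j k) (P j b k))
    (class_CZ (-1) (P k b j)) Ux).
  rewrite (partialD _ oU (P b j k) (P j b k) Ux).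
  by rewrite (partialZ _ _ oU (P k b j) Ux) mulN1r.
have := partialC l i oU C2 Ux; rewrite !E.
have -> : dd l i j k = dd i l j k := partialC l i oU (Ce j k) Ux.
by clearbody dd; rewrite -!addrA => /addrI.
Qed.

End Compatibility.

(** * An Airy stress that no isotropic eigenstrain generates *)

Section AiryStress.
Variables (R : realType) (r : R) (c : vect R).
Implicit Types (U A : set (vect R)) (x : vect R) (i j k l : 'I_3).

(** The Airy stress of the potential in each plane orthogonal to the last axis; its
    rows are divergence free because partial derivatives commute. *)
Definition airy_entry (i j : 'I_3) : vect R -> R :=
  match val i, val j with
  | 0%N, 0%N => potential_deriv r c [:: 0; 2; 0]%N
  | 1%N, 1%N => potential_deriv r c [:: 2; 0; 0]%N
  | 0%N, 1%N | 1%N, 0%N => fun x => -1 * potential_deriv r c [:: 1; 1; 0]%N x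
  | _, _ => fun=> 0
  end.

Definition airy_stress : tensor_field R := fun x => \matrix_(i, j) airy_entry i j x.

Lemma airy_stressE i j : (fun x => airy_stress x i j) = airy_entry i j.
Proof. by apply/funext => x; rewrite mxE. Qed.

Lemma airy_stress_sym x : (airy_stress x)^T = airy_stress x.
Proof. by apply/matrixP; elim/ord3_cases; elim/ord3_cases; rewrite !mxE. Qed.

Lemma class_C_airy_stress A : class_C_tensor 2 A airy_stress.
Proof.
have B s : (forall i : 'I_3, nth 0%N s i + 2 <= 7)%N ->
  class_C 2 A (potential_deriv r c s) by exact: class_C_potential_deriv.
move=> i j; rewrite airy_stressE.
by elim/ord3_cases: i; elim/ord3_cases: j;
  do ?[exact: class_C_cst | apply: class_CZ]; apply: B; elim/ord3_cases.
Qed.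

Lemma divergence_airy_stress x : divergence airy_stress x = 0.
Proof.
have P s (i : 'I_3) : (nth 0%N s i < 7)%N ->
    partial i (potential_deriv r c s) x = potential_deriv r c (incr_nth s i) x.
  exact: partial_potential_deriv.
have N s (i : 'I_3) : (nth 0%N s i < 7)%N ->
    partial i (fun y => -1 * potential_deriv r c s y) x =
    - potential_deriv r c (incr_nth s i) x.
  move=> si; rewrite -[RHS]mulN1r; apply: is_derive_partial; apply: is_deriveZ.
  exact: is_derive_potential_deriv.
have Z (i : 'I_3) : partial i (fun=> 0 : R) x = 0 by exact: derive_cst.
apply/rowP => j; rewrite !mxE; under eq_bigr do rewrite airy_stressE.
rewrite !big_ord_recl big_ord0 /airy_entry.
by elim/ord3_cases: j; rewrite /= ?P ?N ?Z //= /bump /=; ring.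
Qed.

Lemma airy_stress_outside x : 0 < r -> ~ ball c r x -> airy_stress x = 0.
Proof.
move=> r0 xB; apply/matrixP; elim/ord3_cases; elim/ord3_cases;
  rewrite !mxE /airy_entry //= potential_deriv_outside ?mulr0//; by elim/ord3_cases.
Qed.

(** Two of the compatibility equations give d_1 d_0 h and d_2 d_0 h explicitly; the
    function d_0 h, of class C^1 a priori, thereby gets continuous mixed second
    derivatives in the directions 1 and 2.  Their equality at c says that
    d_0 d_1 d_2 of the Laplacian of the potential vanishes there. *)
Lemma airy_stress_not_conformal U (X : vector_field R) (h : vect R -> R) (a : R) :
  0 < r -> a != 0 -> open U -> U c -> class_C_vector 2 U X -> class_C 2 U h ->
  ~ (forall x, U x -> symgrad X x = a *: airy_stress x + (h x)%:M).
Proof.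
move=> r0 a0 oU Uc CX Ch XE.
have CI i j : class_C 2 U (fun x => (h x)%:M i j : R).
  have [<-|ij] := eqVneq i j.
    by apply: eq_class_C Ch => x _; rewrite mxE eqxx.
  apply: eq_class_C (class_C_cst 2 U 0) => x _.
  by rewrite mxE (negbTE ij).
have Ce : class_C_tensor 2 U (symgrad X).
  move=> i j.
  apply: (@eq_class_C _ _ _ (fun x => a * airy_stress x i j + (h x)%:M i j)).
    by move=> x Ux; rewrite XE// !mxE.
  by apply: class_CD => //; apply: class_CZ; exact: class_C_airy_stress.
pose B := potential_deriv r c.
pose dd k l i j x := partial k (partial l (fun y => symgrad X y i j)) x.
have sv i j k l x : U x -> dd l j i k x - dd l k i j x = dd i j l k x - dd i k l j x.
  exact: saint_venant.
have e i j f : (forall x, a * airy_entry i j x + (h x)%:M i j = f x) ->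
    forall k l x, U x -> dd k l i j x = partial k (partial l f) x.
  move=> H k l x Ux; apply: (eq_partial k oU _ Ux) => y Uy.
  apply: (eq_partial l oU _ Uy) => z Uz.
  by rewrite -H -airy_stressE XE// !mxE.
(* Only the compatibility equations and the second derivatives of the strain
   matter from here on, not the displacement. *)
clearbody dd.
have e11 : forall k l x, U x -> dd k l 1 1 x =
    partial k (partial l (fun x => a * B [:: 2; 0; 0]%N x + h x)) x.
  by apply: e => x; rewrite !mxE.
have e22 : forall k l x, U x -> dd k l 2 2 x = partial k (partial l h) x.
  by apply: e => x; rewrite !mxE mulr0 add0r.
have e01 : forall k l x, U x -> dd k l 0 1 x =
    partial k (partial l (fun x => - a * B [:: 1; 1; 0]%N x)) x.
  by apply: e => x; rewrite !mxE addr0 mulrA mulrN1.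
have Z k l x : partial k (partial l (fun=> 0 : R)) x = 0.
  have -> : partial l (fun=> 0 : R) = fun=> 0.
    by apply/funext => y; exact: derive_cst.
  exact: derive_cst.
have e0 i j : (forall x, a * airy_entry i j x + (h x)%:M i j = 0) ->
    forall k l x, U x -> dd k l i j x = 0.
  by move=> H k l x Ux; rewrite (e _ _ _ H)// Z.
have e02 : forall k l x, U x -> dd k l 0 2 x = 0.
  by apply: e0 => x; rewrite !mxE mulr0 add0r.
have e12 : forall k l x, U x -> dd k l 1 2 x = 0.
  by apply: e0 => x; rewrite !mxE mulr0 add0r.
have e21 : forall k l x, U x -> dd k l 2 1 x = 0.
  by apply: e0 => x; rewrite !mxE mulr0 add0r.
have dB b s (i : 'I_3) x : (nth 0%N s i < 7)%N ->
    is_derive x (delta_mx 0 i) (fun y => b * B s y) (b * B (incr_nth s i) x).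
  by move=> si; apply: is_deriveZ; exact: is_derive_potential_deriv.
have ddB b s (k l : 'I_3) x : (nth 0%N s l < 7)%N ->
    (nth 0%N (incr_nth s l) k < 7)%N ->
    partial k (partial l (fun y => b * B s y)) x =
    b * B (incr_nth (incr_nth s l) k) x.
  move=> sl sk; have -> : partial l (fun y => b * B s y) =
      fun y => b * B (incr_nth s l) y.
    by apply/funext => y; apply: is_derive_partial; exact: dB.
  by apply: is_derive_partial; exact: dB.
(* Compatibility of the strain components 22 and 01; 02 and 12 vanish. *)
have H1 x : U x -> partial 1 (partial 0 h) x = a * B [:: 1; 1; 2]%N x.
  move=> Ux; rewrite (partialC 1 0 oU Ch Ux); have := sv 2 1 2 0 x Ux.
  rewrite (e22 0 1 x Ux) (e21 0 2 x Ux) (e02 2 1 x Ux) (e01 2 2 x Ux).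
  rewrite (ddB (- a) [:: 1; 1; 0]%N)//=.
  by rewrite subr0 sub0r mulNr opprK.
(* Compatibility of the strain components 11 and 01. *)
have H2 x : U x -> partial 2 (partial 0 h) x =
    - a * B [:: 1; 2; 1]%N x - a * B [:: 3; 0; 1]%N x.
  move=> Ux; rewrite (partialC 2 0 oU Ch Ux); have := sv 1 2 1 0 x Ux.
  rewrite (e11 0 2 x Ux) (e12 0 1 x Ux) (e02 1 1 x Ux) (e01 1 2 x Ux).
  rewrite (partial2D 0 2 oU _ Ch Ux); last first.
    by apply: class_CZ; apply: class_C_potential_deriv; elim/ord3_cases.
  rewrite (ddB a [:: 2; 0; 0]%N)// (ddB (- a) [:: 1; 1; 0]%N)//= !subr0 => <-.
  by rewrite addrAC subrr add0r.
have Ch1 := class_C_partial 0 oU Ch.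
have CB b s : continuous (fun x => b * B s x).
  move=> x; apply: (@continuousM _ _ (cst b)); first exact: cst_continuous.
  exact: potential_deriv_continuous.
have D1 x : U x -> is_derive x (delta_mx 0 1) (partial 0 h) (a * B [:: 1; 1; 2]%N x).
  by move=> Ux; rewrite -H1//; exact: class_C_is_derive Ch1 Ux.
have D2 x : U x -> is_derive x (delta_mx 0 2) (partial 0 h)
    (- a * B [:: 1; 2; 1]%N x - a * B [:: 3; 0; 1]%N x).
  by move=> Ux; rewrite -H2//; exact: class_C_is_derive Ch1 Ux.
have D12 x : U x -> is_derive x (delta_mx 0 2) (fun y => a * B [:: 1; 1; 2]%N y)
    (a * B [:: 1; 1; 3]%N x).
  by move=> _; exact: (dB a [:: 1; 1; 2]%N 2 x).
have D21 x : U x -> is_derive x (delta_mx 0 1)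
    (fun y => - a * B [:: 1; 2; 1]%N y - a * B [:: 3; 0; 1]%N y)
    (- a * B [:: 1; 3; 1]%N x - a * B [:: 3; 1; 1]%N x).
  move=> _; apply: is_deriveB; first exact: (dB (- a) [:: 1; 2; 1]%N 1 x).
  exact: (dB a [:: 3; 0; 1]%N 1 x).
have C12 : {in U, continuous (fun x => a * B [:: 1; 1; 3]%N x)}.
  by move=> x _; exact: CB.
have C21 : {in U, continuous
    (fun x => - a * B [:: 1; 3; 1]%N x - a * B [:: 3; 1; 1]%N x)}.
  move=> x _.
  pose f1 x : R := - a * B [:: 1; 3; 1]%N x; pose f2 x : R := a * B [:: 3; 1; 1]%N x.
  apply: (@continuousB _ _ _ f1 f2); exact: CB.
have := mixed_derivatives_commute oU D1 D2 D12 D21 C12 C21 Uc.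
have Bc s : B s c =
    bump_deriv r (nth 0%N s 0) 0 *
    (bump_deriv r (nth 0%N s 1) 0 * bump_deriv r (nth 0%N s 2) 0).
  by rewrite /B /potential_deriv !big_ord_recl big_ord0 mulr1 !subrr.
rewrite !Bc /=.
have := bump_deriv_at0 r0; set p := bump_deriv r 1 0; set q := bump_deriv r 3 0.
move=> pq E; have : a * (p ^+ 2 * q) *+ 3 = 0.
  by rewrite -mulr_natr; lra.
by move/eqP; rewrite mulrn_eq0 /= mulf_eq0 (negbTE a0) (negbTE pq).
Qed.

End AiryStress.

(** * The residual stress *)

Lemma symgrad_sym (R : realType) (X : vector_field R) x : (symgrad X x)^T = symgrad X x.
Proof. by apply/matrixP => i j; rewrite !mxE addrC. Qed.

Lemma symgrad0 (R : realType) x : symgrad (fun=> 0 : vect R) x = 0.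
Proof.
have Z (i : 'I_3) : partial i (fun=> 0 : R) x = 0 by exact: derive_cst.
by apply/matrixP => i j; rewrite !mxE !Z addr0 mulr0.
Qed.

Lemma ddot0 (R : realType) (C : tensor4 R) : ddot C 0 = 0.
Proof.
apply/matrixP => i j; rewrite !mxE big1// => k _; rewrite big1// => l _.
by rewrite mxE mulr0.
Qed.

Lemma ddotN (R : realType) (C : tensor4 R) A : ddot C (- A) = - ddot C A.
Proof.
apply/matrixP => i j; rewrite !mxE -sumrN; apply: eq_bigr => k _.
by rewrite -sumrN; apply: eq_bigr => l _; rewrite mxE mulrN.
Qed.

Lemma divergence0 (R : realType) x : divergence (fun=> 0 : 'M[R]_3) x = 0.
Proof. by apply/rowP => j; rewrite !mxE big1// => i _; exact: derive_cst. Qed.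

Theorem corollary1 (R : realType) (Omega : set (vect R)) (C : tensor4 R)
    (Omega_compact : compact Omega)
    (Omega_interior : Omega° !=set0)
    (Omega_lipschitz : lipschitz_boundary Omega)
    (C_elastic : isotropic_elasticity_tensor C) :
  exists sigma : tensor_field R,
    (exists2 eps : tensor_field R,
       eigenstrain Omega eps & generates C Omega eps sigma) /\
    ~ (exists2 f : vect R -> R,
         class_C 2 Omega f & generates C Omega (isotropic_field f) sigma).
Proof.
have [c Oc] := Omega_interior.
have oU : open Omega° by exact: open_interior.
have [r /= r0 rU] : exists2 r : R, 0 < r & ball c r `<=` Omega°.
  have /nbhs_ballP[r r0 rU] : nbhs c Omega° by exact: open_nbhs_nbhs.
  by exists r.
have [lam [mu [mu0 k0 CE]]] := lame_law C_elastic.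
pose S := airy_stress r c.
have ST x : (S x)^T = S x := airy_stress_sym r c x.
(* Zero displacement and eigenstrain C^-1 : S generate C : (0 - C^-1 : S). *)
exists (fun x => - S x); split.
  exists (fun x => compliance lam mu (S x)).
    split; first by move=> x _; exact: compliance_sym.
    by apply: class_C_compliance; exact: class_C_airy_stress.
  have Ceps y : ddot C (compliance lam mu (S y)) = S y.
    exact: ddot_compliance.
  exists (fun=> 0), (fun=> 0); split; first split.
  - by move=> i; exact: class_C_cst.
  - by move=> i j; exact: class_C_cst.
  - by move=> x _; rewrite symgrad0.
  - move=> x _; under [in RHS]eq_fun do rewrite Ceps.
    rewrite divergence_airy_stress.
    under eq_fun do rewrite symgrad0 ddot0.
    exact: divergence0.
  - move=> x n [_ xU] _; rewrite Ceps ddot0 /S airy_stress_outside//.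
    by move=> /rU.
  by move=> x _; rewrite sub0r ddotN Ceps.
move=> [f Cf [X [E [[CX CE0 EX _ _] sE]]]].
have CU : class_C 2 Omega° f by apply: class_C_subset (@interior_subset _ Omega) _.
pose b := - (lam / (2 * mu * (2 * mu + 3 * lam))).
have CtrS : class_C 2 Omega° (fun x => f x + - b * \tr (S x)).
  apply: class_CD => //; apply: class_CZ; apply: class_C_mxtrace.
  exact: class_C_airy_stress.
apply: (@airy_stress_not_conformal _ r c Omega° X _ (- (2 * mu)^-1) r0 _ oU Oc CX CtrS).
  by rewrite oppr_eq0 invr_eq0 mulf_neq0 ?gt_eqF// pnatr_eq0.
move=> x Ux; have Ox := interior_subset Ux.
have := congr1 (compliance lam mu) (sE x Ox).
rewrite (compliance_ddot mu0 k0 CE) EX//; last first.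
  by rewrite linearB /= symgrad_sym tr_scalar_mx.
move=> /esym/eqP; rewrite subr_eq => /eqP ->.
have trN : \tr (- S x) = - \tr (S x) by rewrite raddfN.
apply/matrixP => i j; rewrite /compliance -/b trN !mxE.
by case: (i == j); rewrite ?mulr1n ?mulr0n; ring.
Qed.
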